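(* Let $D^d$ be the space of $\mathbb{R}^d$-valued càdlàg functions on $[0,\infty)$ with the $J_1$-topology, $D_\uparrow$ the space of non-decreasing $[0,\infty)$-valued càdlàg functions on $[0,\infty)$ with the $M_1$-topology, $C^d\subset D^d$ the continuous functions and $D_{\uparrow\uparrow}\subset D_\uparrow$ the strictly increasing ones. Then the composition map $D^d\times D_\uparrow\to D^d$, $(x,y)\mapsto x\circ y$, where the target carries the $L^1_{\mathrm{loc}}$-topology, is continuous at every point $(x,y)\in(C^d\times D_\uparrow)\cup(D^d\times D_{\uparrow\uparrow})$.
   Context: $J_1$-topology: with $\Lambda_T$ the strictly increasing continuous bijections $\lambda:[0,T]\to[0,T]$, $d^T_{J_1}(f_1,f_2)=\inf_{\lambda\in\Lambda_T}\{\sup_{t\le T}|\lambda(t)-t|\vee\sup_{t\le T}|f_1(\lambda(t))-f_2(t)|\}$ and $d_{J_1}=\int_0^\infty e^{-T}(d^T_{J_1}\wedge1)dT$. $M_1$-topology (for real-valued paths): with $\Gamma_f(T)=\{(s,z)\in[0,T]\times\mathbb{R}:z=\theta f(s-)+(1-\theta)f(s),\theta\in[0,1]\}$ and $\Pi_f(T)$ the continuous surjections $(r,u):[0,1]\to\Gamma_f(T)$ with $r(0)=0$, $r(1)=T$ (parametric representations), $d^T_{M_1}(f_1,f_2)=\inf_{(r_i,u_i)\in\Pi_{f_i}(T)}\{\sup|r_1-r_2|\vee\sup|u_1-u_2|\}$ and $d_{M_1}=\int_0^\infty e^{-T}(d^T_{M_1}\wedge1)dT$. $L^1_{\mathrm{loc}}$-topology: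 $f_n\to f$ iff $\int_0^T|f_n(t)-f(t)|dt\to0$ for every $T>0$. *)

(* Defs.v *)
From HB Require Import structures.
From mathcomp Require Import all_boot all_order all_algebra.
From mathcomp Require Import all_classical all_reals all_analysis.
Set Implicit Arguments. Unset Strict Implicit. Unset Printing Implicit Defensive.
Import Order.TTheory GRing.Theory Num.Theory.
Import numFieldNormedType.Exports.
Local Open Scope classical_set_scope.
Local Open Scope ring_scope.

Section Defs.
Variable R : realType.

(* Paths are functions on R; only their values on [0, +oo) are ever used. *)

Definition cadlag (V : normedModType R) (f : R -> V) : Prop :=
  (forall t : R, 0 <= t -> f @ at_right t --> f t) /\
  (forall t : R, 0 < t -> cvg (f @ at_left t)).

(* f(s-), with the usual convention f(0-) = f(0). *)
Definition left_lim (V : normedModType R) (f : R -> V) (s : R) : V :=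
  if s <= 0 then f s else lim (f @ at_left s).

Definition in_D (d : nat) (f : R -> 'rV[R]_d) : Prop := cadlag f.

Definition in_C (d : nat) (f : R -> 'rV[R]_d) : Prop :=
  cadlag f /\ (forall t : R, 0 < t -> {for t, continuous f}).

Definition in_Dup (f : R -> R) : Prop :=
  cadlag f /\ (forall t : R, 0 <= t -> 0 <= f t) /\
  (forall s t : R, 0 <= s -> s <= t -> f s <= f t).

Definition in_Dupup (f : R -> R) : Prop :=
  in_Dup f /\ (forall s t : R, 0 <= s -> s < t -> f s < f t).

Definition in_Lambda (T : R) (lam : R -> R) : Prop :=
  (forall s t : R, 0 <= s -> s < t -> t <= T -> lam s < lam t) /\
  {within `[0, T], continuous lam} /\
  (forall t : R, 0 <= t <= T -> 0 <= lam t <= T) /\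
  (forall u : R, 0 <= u <= T -> exists2 t : R, 0 <= t <= T & lam t = u).

Definition dJ1T (d : nat) (T : R) (f1 f2 : R -> 'rV[R]_d) : R :=
  inf [set e : R | exists lam : R -> R, in_Lambda T lam /\
        e = Num.max (sup [set `|lam t - t| | t in `[0, T]])
                    (sup [set `|f1 (lam t) - f2 t| | t in `[0, T]])].

Definition dJ1 (d : nat) (f1 f2 : R -> 'rV[R]_d) : \bar R :=
  (\int[lebesgue_measure]_(T in `[0%R, +oo[)
      (expR (- T) * Num.min (dJ1T T f1 f2) 1)%:E)%E.

Definition Gamma (f : R -> R) (T : R) : set (R * R) :=
  [set p | 0 <= p.1 <= T /\
     exists2 th : R, 0 <= th <= 1 &
       p.2 = th * left_lim f p.1 + (1 - th) * f p.1].

Definition in_Pi (f : R -> R) (T : R) (r u : R -> R) : Prop :=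
  {within `[0, 1], continuous r} /\ {within `[0, 1], continuous u} /\
  (forall s : R, 0 <= s <= 1 -> Gamma f T (r s, u s)) /\
  (forall p, Gamma f T p -> exists2 s : R, 0 <= s <= 1 & (r s, u s) = p) /\
  r 0 = 0 /\ r 1 = T.

Definition dM1T (T : R) (f1 f2 : R -> R) : R :=
  inf [set e : R | exists r1 u1 r2 u2 : R -> R,
        in_Pi f1 T r1 u1 /\ in_Pi f2 T r2 u2 /\
        e = Num.max (sup [set `|r1 s - r2 s| | s in `[0, 1]])
                    (sup [set `|u1 s - u2 s| | s in `[0, 1]])].

Definition dM1 (f1 f2 : R -> R) : \bar R :=
  (\int[lebesgue_measure]_(T in `[0%R, +oo[)
      (expR (- T) * Num.min (dM1T T f1 f2) 1)%:E)%E.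

Definition L1loc_cvg (d : nat) (fs : nat -> R -> 'rV[R]_d)
    (f : R -> 'rV[R]_d) : Prop :=
  forall T : R, 0 < T ->
    (fun n => (\int[lebesgue_measure]_(t in `[0%R, T])
                 (`|fs n t - f t|)%:E)%E) @ \oo --> 0%E.

End Defs.

(* Main.v *)
Require Import Defs.
From mathcomp Require Import all_boot all_order all_algebra.
From mathcomp Require Import all_classical all_reals all_analysis.
From mathcomp Require Import measurable_realfun lra ring.

Set Implicit Arguments.
Unset Strict Implicit.
Unset Printing Implicit Defensive.

Import Order.TTheory GRing.Theory Num.Theory.
Import numFieldNormedType.Exports.

Local Open Scope classical_set_scope.
Local Open Scope ring_scope.

(* [J1]-closeness says that every value of [xs n] on a compact is close to a
   value of [x] at a nearby time, and [M1]-closeness of monotone paths squeezes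
   [ys n t] between [y (t - e) - e] and [y (t + e) + e]. Hence
   [xs n (ys n t) -> x (y t)] whenever [y] is continuous at [t] and [x] is
   continuous at [y t]. A function has only countably many discontinuities at
   which it is right-continuous, and a strictly increasing [y] hits those of [x]
   at countably many times only, so that the convergence holds almost everywhere
   and is bounded. *)

Section one_sided_neighborhoods.
Context {R : realType}.
Implicit Types (t : R) (P : set R).

Lemma near_at_right_itvoo t P : (\forall s \near t^'+, P s) ->
  exists2 b, t < b & forall s, t < s < b -> P s.
Proof.
rewrite near_withinE => /nbhs_ballP[e /= e0 te]; exists (t + e).
  by rewrite ltrDl.
move=> s /andP[ts ste]; apply: te => //.
by rewrite /ball/= ltr_distlC ste andbT (lt_trans _ ts)// ltrBlDr ltrDl.
Qed.

Lemma near_at_left_at_right t P : P t ->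
  (\forall s \near t^'-, P s) -> (\forall s \near t^'+, P s) ->
  \forall s \near t, P s.
Proof.
move=> Pt; rewrite !near_withinE; apply: filterS2 => s Ps_left Ps_right.
by have [/Ps_left|/Ps_right|->] := ltgtP s t.
Qed.

Lemma cvg_at_right_comp_nondecreasing (U : topologicalType) (f : R -> U)
    (y : R -> R) t :
  f @ (y t)^'+ --> f (y t) -> y @ t^'+ --> y t ->
  (forall s, t <= s -> y t <= y s) -> (f \o y) @ t^'+ --> (f \o y) t.
Proof.
move=> /cvg_at_right_within fy yt yle; apply: cvg_comp fy.
move=> A /yt; apply: filterS2 (nbhs_right_ge t) => s ts; apply.
exact: yle.
Qed.

End one_sided_neighborhoods.

Section countable_discontinuities.
Context {R : realType}.

(* A rational to the right of [t] and to the left of the rest of [S] identifies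
   [t]. *)
Lemma countable_right_isolated (S : set R) :
  (forall t, S t -> \forall s \near t^'+, ~ S s) -> countable S.
Proof.
move=> isoS.
have gap t : exists q : rat,
    S t -> t < ratr q /\ forall s, t < s < ratr q -> ~ S s.
  have [/isoS/near_at_right_itvoo[b tb noS]|nSt] := pselect (S t);
    last by exists 0.
  have [q] := rat_in_itvoo tb; rewrite in_itv/= => /andP[tq qb].
  exists q => _; split=> // s /andP[ts sq]; apply: noS.
  by rewrite ts (lt_trans sq).
have [q q_gap] := choice gap.
apply/countable_injP; exists (pickle \o q) => s t /set_mem Ss /set_mem St.
move=> /= /(pcan_inj pickleK) qst.
have [[sq noS_s] [tq noS_t]] := (q_gap _ Ss, q_gap _ St).
have [st|ts|//] := ltgtP s t; exfalso.
- by apply: (noS_s t) => //; rewrite st qst.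
- by apply: (noS_t s) => //; rewrite ts -qst.
Qed.

Lemma at_right_small_oscillation (V : pseudoMetricType R) (f : R -> V) t e :
  f @ t^'+ --> f t -> 0 < e ->
  \forall s \near t^'+, \forall u \near s, ball (f s) e (f u).
Proof.
move=> /cvg_ballP rf e0.
have [b tb fb] := near_at_right_itvoo (rf _ (divr_gt0 e0 (ltr0Sn _ 1))).
near=> s.
have stb : s \in `]t, b[.
  rewrite in_itv/=; apply/andP; split; near: s.
    exact: nbhs_right_gt.
  exact: nbhs_right_lt.
apply: filterS (near_in_itvoo stb) => u utb.
by apply: (ball_splitr (z := f t)); apply: fb; [move: stb|move: utb];
  rewrite in_itv.
Unshelve. all: by end_near. Qed.

Lemma countable_right_continuous_discontinuous (V : pseudoMetricType R)
    (f : R -> V) :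
  countable [set t | f @ t^'+ --> f t /\ ~ {for t, continuous f}].
Proof.
pose osc (k : nat) := [set t | f @ t^'+ --> f t /\
  ~ \forall s \near t, ball (f t) k.+1%:R^-1 (f s)].
apply: (@sub_countable _ _ _ (\bigcup_k osc k)).
  apply: subset_card_le => t [rf nct]; apply: contrapT => not_osc.
  apply/nct/cvg_ballP => e e0.
  have [k _ /(_ k (leqnn k)) ke] := near_infty_natSinv_lt (PosNum e0).
  have : \forall s \near t, ball (f t) k.+1%:R^-1 (f s).
    by apply: contrapT => osck; apply: not_osc; exists k.
  by apply: filterS => s; apply: le_ball; exact: ltW.
apply: bigcup_countable => // k _; apply: countable_right_isolated.
move=> t [rf _].
have k0 : (0 : R) < k.+1%:R^-1 by rewrite invr_gt0.
by apply: filterS (at_right_small_oscillation rf k0) => s cs [_].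
Qed.

Lemma countableU {T : Type} (A B : set T) :
  countable A -> countable B -> countable (A `|` B).
Proof.
move=> cA cB; rewrite -bigcup2E.
by apply: bigcup_countable => // -[|[|n]] _ //=.
Qed.

Lemma ae_countable (C : set R) (P : R -> Prop) : countable C ->
  (forall t, ~ C t -> P t) -> {ae @lebesgue_measure R, forall t, P t}.
Proof.
move=> cC CP; exists C; split.
- exact: countable_measurable.
- exact: countable_lebesgue_measure0.
- by move=> t /= nP; apply: contrapT => /CP.
Qed.

Lemma measurable_fun_right_continuous (D : set R) (h : R -> R) :
  measurable D -> (forall t, D t -> h @ t^'+ --> h t) -> measurable_fun D h.
Proof.
move=> mD rh; pose C := [set t | h @ t^'+ --> h t /\ ~ {for t, continuous h}].
have mC A : A `<=` C -> measurable A.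
  move=> AC; apply: countable_measurable => //.
  apply: sub_countable (subset_card_le AC) _.
  exact: countable_right_continuous_discontinuous.
have mDC : measurable (D `\` C) by apply: measurableD => //; exact: mC.
have mDIC : measurable (D `&` C) by apply: mC; exact: subIsetr.
have -> : D = (D `\` C) `|` (D `&` C) by rewrite setUC setUIDK.
apply/measurable_funU => //; split.
- apply: subspace_continuous_measurable_fun => //.
  apply/subspace_continuousP => t [Dt nCt]; apply: cvg_within_filter.
  by apply: contrapT => nct; apply: nCt; split => //; exact: rh.
- by move=> _ Y mY; apply: mC => t [[]].
Qed.

End countable_discontinuities.

Section integration.
Context d (T : measurableType d) (R : realType).
Variable mu : {measure set T -> \bar R}.

(* The library's version asks [f] and [g] to be measurable, which the distances
   [dJ1T] and [dM1T] are not known to be as functions of the horizon. The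
   integral of a nonnegative function is a supremum over the simple functions
   below it, hence monotone without that assumption. *)
Lemma ge0_le_integral_subset (D E : set T) (f g : T -> \bar R) :
  (forall x, D x -> 0 <= f x)%E -> (forall x, E x -> 0 <= g x)%E ->
  D `<=` E -> (forall x, D x -> f x <= g x)%E ->
  (\int[mu]_(x in D) f x <= \int[mu]_(x in E) g x)%E.
Proof.
move=> f0 g0 DE fg; rewrite !ge0_integralE//.
apply: ereal_sup_le => _ [h /= hf <-]; exists h => //= x.
apply: le_trans (hf x) _; rewrite !patchE.
case: ifPn => [/set_mem Dx|_]; first by rewrite mem_set ?fg//; exact: DE.
by case: ifPn => // /set_mem/g0.
Qed.

Lemma bounded_convergence (D : set T) (h : nat -> T -> R) (f : T -> R) (M : R) :
  measurable D -> (mu D < +oo)%E -> (forall n, measurable_fun D (h n)) ->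
  measurable_fun D f ->
  (\forall n \near \oo, forall t, D t -> `|h n t| <= M) ->
  {ae mu, forall t, D t -> h ^~ t @ \oo --> f t} ->
  (fun n => \int[mu]_(t in D) (h n t)%:E)%E @ \oo -->
    (\int[mu]_(t in D) (f t)%:E)%E.
Proof.
move=> mD muD mh mf [N _ hM] hf; rewrite -(cvg_shiftn N).
have [] // := @dominated_convergence _ _ R mu D mD
  (fun n t => (h (n + N)%N t)%:E) (EFin \o f) (cst M%:E).
- by move=> n; exact/measurable_EFinP.
- exact/measurable_EFinP.
- apply: filterS hf => t hft Dt; apply: cvg_EFin; first exact: nearW.
  by rewrite (cvg_shiftn N (h ^~ t)); exact: hft.
- apply/integrableP; split; first exact: measurable_cst.
  by rewrite integral_cst//= lte_mul_pinfty.
- apply: aeW => t n Dt; rewrite /= lee_fin.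
  by apply: hM => //; exact: leq_addl.
Qed.

End integration.

Section boundedness.
Context {R : realType} {V : normedModType R}.

Lemma compact_locally_bounded (T : topologicalType) (K : set T) (f : T -> V) :
  compact K -> (forall t, K t -> bounded_near f (within K (nbhs t))) ->
  [bounded f t | t in K].
Proof.
move=> /compact_near_coveringP/near_covering_withinP cK bf.
have : \forall M \near +oo, K `<=` (fun t => `|f t| <= M).
  apply: cK => t /bf; rewrite /bounded_near => /pinfty_ex_gt0[M _ fM].
  exists ([set s | K s -> `|f s| <= M], [set N | M <= N]) => /=.
    by split; [exact: fM|apply: nbhs_pinfty_ge; exact: num_real].
  by move=> [s N]/= [sM MN] /sM /le_trans; exact.
by apply: filterS => M KM t /KM.
Qed.

Lemma within_continuous_bounded (T : topologicalType) (K : set T) (f : T -> V) :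
  compact K -> {within K, continuous f} -> [bounded f t | t in K].
Proof.
move=> cK /subspace_continuousP cf; apply: compact_locally_bounded => // t Kt.
exact: cvg_bounded _ _ (cf t Kt).
Qed.

Lemma cadlag_bounded (f : R -> V) (T : R) :
  cadlag f -> [bounded f t | t in `[0, T]].
Proof.
move=> [rf lf]; apply: compact_locally_bounded; first exact: segment_compact.
move=> t /=; rewrite in_itv/= => /andP[t0 _].
have bounded_left : \forall M \near +oo,
    \forall s \near t^'-, 0 <= s -> `|f s| <= M.
  move: t0; rewrite le_eqVlt => /predU1P[<-|/lf/cvg_bounded].
    apply: nearW => M; near=> s => s0.
    have : s < 0 by near: s; exact: nbhs_left_lt.
    by rewrite ltNge s0.
  by rewrite /bounded_near; apply: filterS => M; apply: filterS.
have bounded_right : \forall M \near +oo, \forall s \near t^'+, `|f s| <= M.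
  exact: cvg_bounded _ _ (rf t t0).
rewrite /bounded_near; near=> M; apply: near_at_left_at_right => /=.
- by move=> _; near: M; apply: nbhs_pinfty_ge; exact: num_real.
- have : \forall s \near t^'-, 0 <= s -> `|f s| <= M by near: M.
  by apply: filterS => s fM; rewrite in_itv/= => /andP[/fM].
- have : \forall s \near t^'+, `|f s| <= M by near: M.
  exact: filterS.
Unshelve. all: by end_near. Qed.

(* Boundedness keeps the supremum from being the junk value [0]. *)
Lemma sup_dist_lt (T : Type) (A : set T) (f g : T -> V) (e : R) :
  [bounded f t | t in A] -> [bounded g t | t in A] ->
  sup [set `|f t - g t| | t in A] < e -> forall t, A t -> `|f t - g t| < e.
Proof.
move=> /pinfty_ex_gt0[M _ fM] /pinfty_ex_gt0[N _ gN] fge t At.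
apply: le_lt_trans fge; apply: ub_le_sup; last by exists t.
exists (M + N) => _ [s As <-].
by apply: le_trans (ler_normB _ _) _; rewrite lerD ?fM ?gN.
Qed.

End boundedness.

Section nonnegative_bounds.
Context {R : realType}.

Lemma sup_image_ge0 (T : Type) (A : set T) (f : T -> R) :
  (forall t, A t -> 0 <= f t) -> 0 <= sup [set f t | t in A].
Proof.
move=> f0; have [hs|/sup_out ->//] := pselect (has_sup [set f t | t in A]).
have [[_ [t At _]] ub] := hs.
by apply: le_trans (f0 _ At) _; apply: ub_le_sup ub _ _; exists t.
Qed.

Lemma inf_ge0 (A : set R) : (forall a, A a -> 0 <= a) -> 0 <= inf A.
Proof.
move=> A0; have [[A_neq0 _]|/inf_out ->//] := pselect (has_inf A).
exact: lb_le_inf.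
Qed.

End nonnegative_bounds.

Section graph_convergence.
Context {R : realType} {V : normedModType R}.
Implicit Types (f g : R -> V) (S e : R).

Definition graph_close S e f g : Prop := forall w, 0 <= w <= S ->
  exists t, [/\ 0 <= t, `|w - t| < e & `|f w - g t| < e].

Definition graph_cvg (fs : nat -> R -> V) f : Prop :=
  forall S e, 0 <= S -> 0 < e -> \forall n \near \oo, graph_close S e (fs n) f.

End graph_convergence.

Definition nondecreasing_path {R : realType} (f : R -> R) : Prop :=
  forall s t, 0 <= s -> s <= t -> f s <= f t.

Section levy_convergence.
Context {R : realType}.
Implicit Types (f g : R -> R) (S e : R).

Definition levy_close S e f g : Prop := forall t, 0 <= t <= S ->
  f t < g (t + e) + e /\ (e <= t -> g (t - e) - e < f t).

Definition levy_cvg (fs : nat -> R -> R) f : Prop :=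
  forall S e, 0 <= S -> 0 < e -> \forall n \near \oo, levy_close S e (fs n) f.

End levy_convergence.

Section horizon_integral.
Context {R : realType}.

Lemma exp_integral_lt (F : R -> R) (S e : R) :
  (forall T, 0 <= F T) -> 0 <= S -> 0 < e ->
  (\int[lebesgue_measure]_(T in `[0%R, +oo[)
      (expR (- T) * Num.min (F T) 1)%:E <
    (expR (- (S + 1)) * Num.min e 1)%:E)%E ->
  exists2 T, S <= T <= S + 1 & F T < e.
Proof.
move=> F0 S0 e0; set c := expR _ * _; apply: contraPP => F_ge.
apply/negP; rewrite -leNgt.
have -> : c%:E = (\int[lebesgue_measure]_(T in `[S, (S + 1)%R]) cst c%:E T)%E.
  rewrite integral_cst//= lebesgue_measure_itv/= lte_fin ltrDl ltr01 -EFinD.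
  by rewrite addrAC subrr add0r mule1.
have min_ge0 (a : R) : 0 <= a -> 0 <= Num.min a 1.
  by move=> a0; rewrite le_min a0 ler01.
apply: ge0_le_integral_subset => [T _|T _|T|T] /=.
- by rewrite lee_fin mulr_ge0 ?expR_ge0 ?min_ge0// ltW.
- by rewrite lee_fin mulr_ge0 ?expR_ge0 ?min_ge0.
- by rewrite !in_itv/= andbT => /andP[/(le_trans S0)].
- rewrite in_itv/= => ST; have /andP[_ TS] := ST.
  rewrite lee_fin ler_pM ?expR_ge0 ?min_ge0 ?(ltW e0)//.
    by rewrite ler_expR lerN2.
  have eF : e <= F T by rewrite leNgt; apply/negP => FT; apply: F_ge; exists T.
  by rewrite le_min !ge_min eF lexx orbT.
Qed.

Lemma cvg_exp_integral_near (F : nat -> R -> R) (S e : R) :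
  (forall n T, 0 <= F n T) -> 0 <= S -> 0 < e ->
  (fun n => \int[lebesgue_measure]_(T in `[0%R, +oo[)
      (expR (- T) * Num.min (F n T) 1)%:E)%E @ \oo --> 0%E ->
  \forall n \near \oo, exists2 T, S <= T <= S + 1 & F n T < e.
Proof.
move=> F0 S0 e0 IF0; set c : R := expR (- (S + 1)) * Num.min e 1.
have c0 : 0 < c by rewrite mulr_gt0 ?expR_gt0// lt_min e0 ltr01.
have : \forall n \near \oo, (\int[lebesgue_measure]_(T in `[0%R, +oo[)
    (expR (- T) * Num.min (F n T) 1)%:E < c%:E)%E.
  apply: (IF0 [set x | (x < c%:E)%E]).
  by apply: open_ereal_lt'; rewrite lte_fin.
by apply: filterS => n; exact: exp_integral_lt.
Qed.

End horizon_integral.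

Section J1_distance.
Context {R : realType} {d : nat}.
Implicit Types (f : R -> 'rV[R]_d) (T e : R).

Lemma in_Lambda_id T : in_Lambda T id.
Proof.
split=> //; split; first by apply: continuous_subspaceT => t; exact: cvg_id.
by split => // u uT; exists u.
Qed.

Lemma dJ1T_ge0 T f1 f2 : 0 <= dJ1T T f1 f2.
Proof. by apply: inf_ge0 => _ [lam [_ ->]]; rewrite le_max sup_image_ge0. Qed.

Lemma dJ1T_lt_graph_close T e f1 f2 :
  cadlag f1 -> cadlag f2 -> dJ1T T f1 f2 < e -> graph_close T e f1 f2.
Proof.
move=> c1 c2 /inf_lt[|_ [lam [[_ [clam [lamT lam_surj]]] ->]]].
  by eexists; exists id; split; [exact: in_Lambda_id|].
rewrite gt_max => /andP[lam_near_id f_near] w /lam_surj[t t0T <-].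
have cT : compact `[0, T] by exact: segment_compact.
have tT : [set` `[0, T]] t by rewrite /= in_itv.
exists t; split; first by case/andP : t0T.
- apply: (sup_dist_lt (f := lam) (g := id) _ _ lam_near_id tT).
    exact: within_continuous_bounded.
  exact: compact_bounded.
- apply: (sup_dist_lt (f := f1 \o lam) (g := f2) _ _ f_near tT).
    have := cadlag_bounded T c1; rewrite /bounded_near.
    apply: filterS => M f1M s; rewrite /= in_itv/= => /lamT sT.
    by apply: f1M; rewrite /= in_itv.
  exact: cadlag_bounded.
Qed.

Lemma dJ1_cvg_graph_cvg (fs : nat -> R -> 'rV[R]_d) f :
  cadlag f -> (forall n, cadlag (fs n)) ->
  (fun n => dJ1 (fs n) f) @ \oo --> 0%E -> graph_cvg fs f.
Proof.
move=> cf cfs dfs S e S0 e0.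
have := cvg_exp_integral_near (fun n T => dJ1T_ge0 T (fs n) f) S0 e0 dfs.
apply: filterS => n [T /andP[ST _] dT] w /andP[w0 wS].
by apply: (dJ1T_lt_graph_close (cfs n) cf dT); rewrite w0 (le_trans wS).
Qed.

End J1_distance.

Section monotone_completed_graph.
Context {R : realType} (f : R -> R).
Hypotheses (cf : cadlag f) (ndf : nondecreasing_path f).

Lemma left_lim0 : left_lim f 0 = f 0.
Proof. by rewrite /left_lim lexx. Qed.

Lemma cvg_left_lim s : 0 < s -> f @ s^'- --> left_lim f s.
Proof. by move=> s0; rewrite /left_lim (lt_geF s0); exact: cf.2. Qed.

Lemma left_lim_ge w s : 0 <= w -> w < s -> f w <= left_lim f s.
Proof.
move=> w0 ws; apply: cvgr_to_ge (cvg_left_lim (le_lt_trans w0 ws)) _.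
near=> u; apply: ndf => //; apply: ltW.
by near: u; exact: nbhs_left_gt.
Unshelve. all: by end_near. Qed.

Lemma left_lim_le s : 0 <= s -> left_lim f s <= f s.
Proof.
rewrite le_eqVlt => /predU1P[<-|s0]; first by rewrite left_lim0.
apply: cvgr_to_le (cvg_left_lim s0) _.
near=> u; apply: ndf; first by near: u; exact: nbhs_left_ge.
by apply: ltW; near: u; exact: nbhs_left_lt.
Unshelve. all: by end_near. Qed.

Lemma in_GammaP T t z :
  Gamma f T (t, z) <-> 0 <= t <= T /\ left_lim f t <= z <= f t.
Proof.
split=> [[/= tT [th /andP[th0 th1] ->]]|[tT /andP[lz zf]]].
  have /andP[/left_lim_le lf _] := tT.
  by split => //; apply/andP; split; nra.
split=> //=; have /andP[t0 _] := tT.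
have [lf|lf] := eqVneq (left_lim f t) (f t).
  by exists 0; [rewrite lexx ler01|rewrite mul0r add0r subr0 mul1r; lra].
have jump : 0 < f t - left_lim f t.
  by rewrite subr_gt0 lt_neqAle lf left_lim_le.
exists ((f t - z) / (f t - left_lim f t)); last by field; rewrite gt_eqF.
rewrite divr_ge0 ?subr_ge0 ?left_lim_le//= ler_pdivrMr// mul1r.
by rewrite lerD2l lerN2.
Qed.

Lemma in_Gamma_graph T t : 0 <= t <= T -> Gamma f T (t, f t).
Proof.
move=> tT; apply/in_GammaP; rewrite lexx andbT left_lim_le//.
by case/andP : tT.
Qed.

Variable T : R.
Hypothesis T0 : 0 <= T.

(* The completed graph of a monotone path is totally ordered, so that it is
   parametrized by the sum of the two coordinates; [graph_time v] is the time of
   its point with coordinate sum [v]. *)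
Definition graph_before v : set R :=
  [set t | 0 <= t <= T /\ forall s, 0 <= s < t -> s + f s <= v].

Definition graph_time v : R := sup (graph_before v).

Let graph_before0 v : graph_before v 0.
Proof.
by split; [rewrite lexx|move=> s /andP[s0 /(le_lt_trans s0)]; rewrite ltxx].
Qed.

Let has_ubound_graph_before v : has_ubound (graph_before v).
Proof. by exists T => t [/andP[]]. Qed.

Lemma graph_time_itv v : 0 <= graph_time v <= T.
Proof.
apply/andP; split; first exact: ub_le_sup.
by apply: ge_sup; [exists 0|move=> t [/andP[]]].
Qed.

Lemma lt_graph_time v s : 0 <= s -> s < graph_time v -> s + f s <= v.
Proof.
move=> s0 /sup_gt[|t [_ tv] st]; first by exists 0.
by apply: tv; rewrite s0.
Qed.

Lemma gt_graph_time v s : graph_time v < s -> s <= T -> v <= s + f s.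
Proof.
have /andP[g0 _] := graph_time_itv v => gs sT; rewrite leNgt; apply/negP => sv.
have : s <= graph_time v; last by rewrite leNgt gs.
apply: ub_le_sup => //; split; first by rewrite sT (le_trans g0 (ltW gs)).
move=> u /andP[u0 us]; apply: le_trans (ltW sv).
by rewrite lerD ?ndf// ltW.
Qed.

Lemma graph_time_lipschitz v v' : `|graph_time v - graph_time v'| <= `|v - v'|.
Proof.
wlog vv' : v v' / v <= v'.
  move=> lip; have [/lip//|/ltW/lip] := leP v v'.
  by rewrite [leLHS]distrC [leRHS]distrC.
have /andP[g0 gT] := graph_time_itv v; have /andP[g0' gT'] := graph_time_itv v'.
have gg' : graph_time v <= graph_time v'.
  apply: ge_sup; first by exists 0.
  move=> t [tT tv]; apply: ub_le_sup => //; split=> // s /tv/le_trans; exact.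
rewrite !ler0_norm ?subr_le0// !opprB leNgt; apply/negP => gap.
pose e := (graph_time v' - graph_time v - (v' - v)) / 3.
have e0 : 0 < e by rewrite /e; lra.
have eE : 3 * e = graph_time v' - graph_time v - (v' - v).
  by rewrite /e mulrC divfK.
have : v <= graph_time v + e + f (graph_time v + e).
  by apply: gt_graph_time; lra.
have : graph_time v' - e + f (graph_time v' - e) <= v'.
  by apply: lt_graph_time; lra.
have : f (graph_time v + e) <= f (graph_time v' - e) by apply: ndf; lra.
lra.
Qed.

Lemma continuous_graph_time : continuous graph_time.
Proof.
move=> v; apply/cvgrPdist_lt => e e0.
apply: filterS (nbhsx_ballx v e e0) => v'.
exact/le_lt_trans/graph_time_lipschitz.
Qed.

Lemma in_Gamma_graph_time v : f 0 <= v <= T + f T ->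
  Gamma f T (graph_time v, v - graph_time v).
Proof.
move=> /andP[fv vT]; have /andP[g0 gT] := graph_time_itv v.
apply/in_GammaP; rewrite g0 gT; split => //; apply/andP; split.
  move: (g0); rewrite le_eqVlt => /predU1P[<-|gp].
    by rewrite left_lim0 subr0.
  have vB : (fun s => v - s) @ (graph_time v)^'- --> v - graph_time v.
    by apply: cvgB; [exact: cvg_cst|apply: cvg_at_left_filter; exact: cvg_id].
  apply: ler_cvg_to (cvg_left_lim gp) vB _.
  near=> s; rewrite lerBrDl; apply: lt_graph_time.
    by near: s; exact: nbhs_left_ge.
  by near: s; exact: nbhs_left_lt.
move: (gT); rewrite le_eqVlt => /predU1P[->|gT']; first by rewrite lerBlDl.
rewrite lerBlDl.
have fD : (fun s => s + f s) @ (graph_time v)^'+ -->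
    graph_time v + f (graph_time v).
  by apply: cvgD; [apply: cvg_at_right_filter; exact: cvg_id|exact: cf.1].
apply: cvgr_to_ge fD _.
near=> s; apply: gt_graph_time; near: s; first exact: nbhs_right_gt.
exact: nbhs_right_le.
Unshelve. all: by end_near. Qed.

Lemma graph_timeE t z : Gamma f T (t, z) -> graph_time (t + z) = t.
Proof.
move=> /in_GammaP[/andP[t0 tT] /andP[lz zf]].
have /andP[g0 gT] := graph_time_itv (t + z).
apply/eqP; rewrite eq_le !leNgt; apply/andP; split; apply/negP.
  move=> tg; have [tm mg] := midf_lt tg.
  have := lt_graph_time (le_trans t0 (ltW tm)) mg.
  have := ndf t0 (ltW tm).
  lra.
move=> gt; have [gm mt] := midf_lt gt.
have := gt_graph_time gm (le_trans (ltW mt) tT).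
have := left_lim_ge (le_trans g0 (ltW gm)) mt.
lra.
Qed.

Lemma Gamma_coord_sum t z : Gamma f T (t, z) -> f 0 <= t + z <= T + f T.
Proof.
move=> /in_GammaP[/andP[t0 tT] /andP[lz zf]]; apply/andP; split.
  move: t0; rewrite le_eqVlt => /predU1P[t0|t0].
    by rewrite -t0 add0r -left_lim0 t0.
  have := left_lim_ge (lexx 0) t0; lra.
by rewrite lerD// (le_trans zf)// ndf.
Qed.

(* Without this, [dM1T] could be the junk value [inf set0 = 0]. *)
Lemma in_Pi_exists : exists r u, in_Pi f T r u.
Proof.
pose v := line_path (f 0) (T + f T).
have fvT : f 0 <= T + f T by rewrite ler_wpDl// ndf.
have cv : continuous v.
  move=> s; apply: cvgD; apply: cvgM;
    [|exact: cvg_cst|exact: cvg_id|exact: cvg_cst].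
  by apply: cvgB; [exact: cvg_cst|exact: cvg_id].
have cg : continuous (graph_time \o v).
  by move=> s; apply: continuous_comp; [exact: cv|exact: continuous_graph_time].
exists (graph_time \o v), (fun s => v s - graph_time (v s)).
split; first exact: continuous_subspaceT.
split.
  by apply: continuous_subspaceT => s; apply: cvgB; [exact: cv|exact: cg].
split.
  move=> s s01; apply: in_Gamma_graph_time.
  have := mem_line_path_itvcc fvT (x := s).
  by rewrite /= !in_itv/=; exact.
split.
  move=> [t z] Gtz.
  have [||s] := @IVT _ v 0 1 (t + z) ler01.
  - exact: continuous_subspaceT.
  - rewrite /v line_path0 line_path1 (min_idPl fvT) (max_idPr fvT).
    exact: Gamma_coord_sum.
  rewrite in_itv => s01 vs; exists s => //=.
  by rewrite vs (graph_timeE Gtz) addrAC subrr add0r.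
rewrite /= /v line_path0 line_path1; split.
  have := graph_timeE (in_Gamma_graph (t := 0) _); rewrite add0r; apply.
  by rewrite lexx.
by apply: graph_timeE; apply: in_Gamma_graph; rewrite T0 lexx.
Qed.

End monotone_completed_graph.

Section M1_distance.
Context {R : realType}.
Implicit Types (f : R -> R) (T e : R).

Lemma dM1T_ge0 T f1 f2 : 0 <= dM1T T f1 f2.
Proof.
apply: inf_ge0 => _ [r1 [u1 [r2 [u2 [_ [_ ->]]]]]].
by rewrite le_max sup_image_ge0.
Qed.

Lemma dM1T_lt_Gamma T e f1 f2 :
  (exists r u, in_Pi f1 T r u) -> (exists r u, in_Pi f2 T r u) ->
  dM1T T f1 f2 < e ->
  forall p, Gamma f1 T p -> exists2 q, Gamma f2 T q & ball p e q.
Proof.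
move=> [r [u Pi1]] [r' [u' Pi2]].
move=> /inf_lt[|_ [r1 [u1 [r2 [u2 [P1 [P2 ->]]]]]]].
  by eexists; exists r, u, r', u'.
rewrite gt_max => /andP[r_near u_near] p.
have [cr1 [cu1 [_ [surj1 _]]]] := P1; have [cr2 [cu2 [G2 _]]] := P2.
move=> /surj1[s s01 <-]; exists (r2 s, u2 s); first exact: G2.
have bounded01 (h : R -> R) :
    {within `[0, 1], continuous h} -> [bounded h t | t in `[0, 1]].
  exact/within_continuous_bounded/segment_compact.
have s_in : [set` `[0, 1]] s by rewrite /= in_itv.
split; rewrite /ball/=.
- exact: (sup_dist_lt (bounded01 _ cr1) (bounded01 _ cr2) r_near).
- exact: (sup_dist_lt (bounded01 _ cu1) (bounded01 _ cu2) u_near).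
Qed.

Lemma dM1T_lt_levy_close T e f1 f2 :
  cadlag f1 -> nondecreasing_path f1 -> cadlag f2 -> nondecreasing_path f2 ->
  0 <= T -> dM1T T f1 f2 < e -> levy_close T e f1 f2.
Proof.
move=> c1 nd1 c2 nd2 T0 d12 t tT.
have [[r z]] := dM1T_lt_Gamma (in_Pi_exists c1 nd1 T0) (in_Pi_exists c2 nd2 T0)
  d12 (in_Gamma_graph c1 nd1 tT).
move=> /(in_GammaP c2 nd2)[/andP[r0 rT] /andP[lz zf]].
rewrite /ball/= => -[]; rewrite /ball/=.
move=> /ltr_normlP[tr rt] /ltr_normlP[f1z zf1].
split.
  have : f2 r <= f2 (t + e) by apply: nd2 => //; lra.
  lra.
move=> et; have : f2 (t - e) <= left_lim f2 r.
  by apply: left_lim_ge => //; lra.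
lra.
Qed.

Lemma dM1_cvg_levy_cvg (fs : nat -> R -> R) f :
  in_Dup f -> (forall n, in_Dup (fs n)) ->
  (fun n => dM1 (fs n) f) @ \oo --> 0%E -> levy_cvg fs f.
Proof.
move=> [cf [_ ndf]] upfs dfs S e S0 e0.
have := cvg_exp_integral_near (fun n T => dM1T_ge0 T (fs n) f) S0 e0 dfs.
apply: filterS => n [T /andP[ST _] dT] t /andP[t0 tS].
have [cfn [_ ndfn]] := upfs n.
apply: (dM1T_lt_levy_close cfn ndfn cf ndf (le_trans S0 ST) dT).
by rewrite t0 (le_trans tS).
Qed.

End M1_distance.

Section path_continuity.
Context {R : realType}.

Definition path_continuous_at (U : topologicalType) (f : R -> U) t : Prop :=
  f @ within [set s | 0 <= s] (nbhs t) --> f t.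

Lemma in_C_path_continuous d (f : R -> 'rV[R]_d) t :
  in_C f -> 0 <= t -> path_continuous_at f t.
Proof.
move=> [[rf _] ctf]; rewrite le_eqVlt => /predU1P[<-|/ctf].
  exact/cvg_at_right_within/rf.
exact: cvg_within_filter.
Qed.

Lemma countable_path_discontinuities (V : normedModType R) (f : R -> V) :
  cadlag f -> countable [set t | 0 <= t /\ ~ path_continuous_at f t].
Proof.
move=> [rf _].
apply: sub_countable (countable_right_continuous_discontinuous f).
apply: subset_card_le => t [/rf rft nct]; split=> // ct; apply: nct.
exact: cvg_within_filter.
Qed.

Lemma path_continuous_at_dist (V : normedModType R) (f : R -> V) t e :
  path_continuous_at f t -> 0 < e ->
  exists2 dl, 0 < dl & forall s, 0 <= s -> `|t - s| < dl -> `|f t - f s| < e.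
Proof.
move=> /cvgrPdist_lt/[apply].
rewrite near_withinE => /nbhs_ballP[dl /= dl0 fdl].
by exists dl => // s s0 ts; exact: fdl.
Qed.

End path_continuity.

Section composition.
Context {R : realType} {V : normedModType R}.
Variables (x : R -> V) (y : R -> R) (xs : nat -> R -> V) (ys : nat -> R -> R).

Lemma levy_cvg_at t : levy_cvg ys y -> 0 < t -> path_continuous_at y t ->
  ys ^~ t @ \oo --> y t.
Proof.
move=> ysy t0 ct; apply/cvgrPdist_lt => e e0.
have e20 : 0 < e / 2 by rewrite divr_gt0.
have [dl dl0 y_near] := path_continuous_at_dist ct e20.
have [m [m0 mdl me mt]] : exists m, [/\ 0 < m, m < dl, m <= e / 2 & m <= t].
  near (0 : R)^'+ => m; exists m; split; near: m.
  - exact: nbhs_right_gt.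
  - exact: nbhs_right_lt.
  - exact: nbhs_right_le.
  - exact: nbhs_right_le.
have /ltr_normlP[yD _] : `|y t - y (t + m)| < e / 2.
  by apply: y_near; rewrite ?opprD ?addNKr ?normrN ?gtr0_norm//; lra.
have /ltr_normlP[_ yB] : `|y t - y (t - m)| < e / 2.
  by apply: y_near; rewrite ?subKr ?gtr0_norm//; lra.
apply: filterS (ysy t m (ltW t0) m0) => n /(_ t).
rewrite (ltW t0) lexx => /(_ isT)[ub /(_ mt) lb].
by apply/ltr_normlP; split; lra.
Unshelve. all: by end_near. Qed.

Lemma graph_cvg_at w (ws : nat -> R) : graph_cvg xs x ->
  0 <= w -> (forall n, 0 <= ws n) -> path_continuous_at x w ->
  ws @ \oo --> w -> (fun n => xs n (ws n)) @ \oo --> x w.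
Proof.
move=> xsx w0 ws0 cw /cvgrPdist_lt wsw; apply/cvgrPdist_lt => e e0.
have e20 : 0 < e / 2 by rewrite divr_gt0.
have [dl dl0 x_near] := path_continuous_at_dist cw e20.
pose m := Num.min (dl / 2) (e / 2).
have m0 : 0 < m by rewrite /m lt_min e20 divr_gt0.
near=> n.
have wn1 : `|w - ws n| < 1 by near: n; exact: wsw.
have wndl : `|w - ws n| < dl / 2 by near: n; apply: wsw; rewrite divr_gt0.
have close : graph_close (w + 1) m (xs n) x.
  by near: n; apply: xsx; rewrite ?addr_ge0.
have [|t [t0 wnt xnt]] := close (ws n).
  by rewrite ws0/=; have /ltr_normlP[] := wn1; lra.
move: wnt xnt; rewrite !lt_min => /andP[wnt _] /andP[_ xnt].
apply: le_lt_trans (ler_distD (x t) _ _) _.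
rewrite (splitr e) ltrD//; last by rewrite distrC.
apply: x_near => //; apply: le_lt_trans (ler_distD (ws n) _ _) _.
by rewrite (splitr dl) ltrD.
Unshelve. all: by end_near. Qed.

Hypotheses (cx : cadlag x) (upy : in_Dup y) (upys : forall n, in_Dup (ys n)).
Hypotheses (xsx : graph_cvg xs x) (ysy : levy_cvg ys y).

Lemma comp_cvg_at t : 0 < t -> path_continuous_at y t ->
  path_continuous_at x (y t) -> (fun n => xs n (ys n t)) @ \oo --> x (y t).
Proof.
move=> t0 cy cxy; apply: graph_cvg_at => //.
- by apply: upy.2.1; exact: ltW.
- by move=> n; apply: (upys n).2.1; exact: ltW.
- exact: levy_cvg_at.
Qed.

Lemma comp_dist_ae_cvg (T : R) :
  countable [set t | 0 <= t /\ ~ path_continuous_at x (y t)] ->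
  {ae @lebesgue_measure R, forall t, `[0, T]%classic t ->
    (fun n => `|xs n (ys n t) - x (y t)|) @ \oo --> (0 : R)}.
Proof.
move=> cxy.
have := countableU (countable1 0) (countableU
  (countable_path_discontinuities upy.1) cxy).
move=> /ae_countable; apply => t nC; rewrite /= in_itv/= => /andP[t0 _].
apply/norm_cvg0P/subr_cvg0/comp_cvg_at.
- by rewrite lt_def t0 andbT; apply/eqP => t00; apply: nC; left.
- by apply: contrapT => nc; apply: nC; right; left.
- by apply: contrapT => nc; apply: nC; right; right.
Qed.

Lemma comp_eventually_bounded T : 0 <= T -> exists M : R,
  \forall n \near \oo, forall t, 0 <= t <= T -> `|xs n (ys n t) - x (y t)| <= M.
Proof.
move=> T0; pose S := y (T + 1) + 1.
have y_le t : 0 <= t -> t <= T + 1 -> 0 <= y t /\ y t + 1 <= S.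
  by move=> t0 tT; split; [exact: upy.2.1|rewrite lerD2r; exact: upy.2.2].
have S0 : 0 <= S by have := y_le (T + 1); lra.
have [M _ xM] := pinfty_ex_gt0 (cadlag_bounded (S + 1) cx).
exists (1 + M + M); near=> n => t tT; have /andP[t0 tT'] := tT.
have y_close : levy_close T 1 (ys n) y by near: n; exact: ysy.
have x_close : graph_close S 1 (xs n) x by near: n; exact: xsx.
have [ysn_lt _] := y_close t tT.
have [|y_ge0 y_leS] := y_le t t0; first lra.
have [||_ y1_leS] := y_le (t + 1); [lra|lra|].
have [|s [s0 /ltr_normlP[ys_s _] xns]] := x_close (ys n t).
  by rewrite (upys n).2.1//=; lra.
have xs_le : `|x s| <= M by apply: xM; rewrite /= in_itv/= s0/=; lra.
have xy_le : `|x (y t)| <= M by apply: xM; rewrite /= in_itv/= y_ge0/=; lra.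
apply: le_trans (ler_normB _ _) _; rewrite lerD// -(subrK (x s) (xs n _)).
by apply: le_trans (ler_normD _ _) _; rewrite lerD// ltW.
Unshelve. all: by end_near. Qed.

End composition.

Lemma measurable_comp_dist {R : realType} (V : normedModType R)
    (x x' : R -> V) (y y' : R -> R) (T : R) :
  cadlag x -> cadlag x' -> in_Dup y -> in_Dup y' ->
  measurable_fun `[0, T] (fun t => `|x (y t) - x' (y' t)|).
Proof.
have right_comp (z : R -> V) (w : R -> R) t :
    cadlag z -> in_Dup w -> 0 <= t -> (z \o w) @ t^'+ --> (z \o w) t.
  move=> [rz _] [[rw _] [w0 ndw]] t0.
  apply: cvg_at_right_comp_nondecreasing; [exact/rz/w0|exact: rw|].
  by move=> s; exact: ndw.
move=> cx cx' upy upy'; apply: measurable_fun_right_continuous => // t.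
rewrite /= in_itv/= => /andP[t0 _]; apply: cvg_norm; apply: cvgB.
- exact: right_comp cx upy t0.
- exact: right_comp cx' upy' t0.
Qed.

Lemma countable_comp_discontinuities {R : realType} d (x : R -> 'rV[R]_d)
    (y : R -> R) :
  cadlag x -> in_Dup y -> in_C x \/ in_Dupup y ->
  countable [set t | 0 <= t /\ ~ path_continuous_at x (y t)].
Proof.
move=> cx [_ [y0 _]] [Cx|[_ incy]].
  apply: (sub_countable _ (countable0 R)); apply: subset_card_le.
  by move=> t [/y0 yt0]; case; exact: in_C_path_continuous.
have /countable_injP[g g_inj] := countable_path_discontinuities cx.
apply/countable_injP; exists (g \o y) => s t /set_mem[s0 ncs] /set_mem[t0 nct].
move=> /= gst; have yst : y s = y t.
  by apply: g_inj gst; apply: mem_set; split => //; exact: y0.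
have [/(incy _ _ s0)|/(incy _ _ t0)|//] := ltgtP s t; by rewrite yst ltxx.
Qed.

Theorem theorem3p10 (R : realType) (d : nat)
  (x : R -> 'rV[R]_d) (y : R -> R) :
  in_D x -> in_Dup y -> (in_C x \/ in_Dupup y) ->
  forall (xs : nat -> R -> 'rV[R]_d) (ys : nat -> R -> R),
    (forall n, in_D (xs n)) -> (forall n, in_Dup (ys n)) ->
    (fun n => dJ1 (xs n) x) @ \oo --> 0%E ->
    (fun n => dM1 (ys n) y) @ \oo --> 0%E ->
    L1loc_cvg (fun n t => xs n (ys n t)) (fun t => x (y t)).
Proof.
move=> cx upy xy xs ys cxs upys xsx ysy T T0.
have {}xsx := dJ1_cvg_graph_cvg cx cxs xsx.
have {}ysy := dM1_cvg_levy_cvg upy upys ysy.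
have [M dist_le] := comp_eventually_bounded cx upy upys xsx ysy (ltW T0).
have -> : 0%E = (\int[lebesgue_measure]_(t in `[0%R, T]) (cst (0 : R) t)%:E)%E.
  by rewrite integral0.
apply: (@bounded_convergence _ _ _ lebesgue_measure `[0, T]%classic
  (fun n t => `|xs n (ys n t) - x (y t)|) (cst 0) M) => //.
- by rewrite /= lebesgue_measure_itv/= lte_fin T0 -EFinD ltry.
- by move=> n; exact: (measurable_comp_dist (T := T) (cxs n) cx (upys n) upy).
- apply: filterS dist_le => n dist_le t.
  by rewrite /= in_itv/= normr_id => /dist_le.
- by apply: comp_dist_ae_cvg => //; exact: countable_comp_discontinuities.
Qed.
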